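(* Let $f$ be an orientation-preserving homeomorphism of the circle $\mathbb T=\mathbb R/\mathbb Z$. Then ${\rm h_{pol}}(f)\in\{0,1\}$, and ${\rm h_{pol}}(f)=0$ if and only if $f$ is topologically conjugate to a rotation of $\mathbb T$.
   Context: For a continuous map $f:X\to X$ of a compact metric space $(X,d)$ define the dynamical metrics $d_n^f(x,y)=\max_{0\le k\le n-1}d(f^k(x),f^k(y))$. For $Y\subset X$ and $\varepsilon>0$ let $G_n^f(Y,\varepsilon)$ be the minimal number of $d_n^f$-balls of radius $\varepsilon$ needed to cover $Y$. The polynomial entropy of $f$ on $Y$ is ${\rm h_{pol}}(f,Y)=\lim_{\varepsilon\to0}\limsup_{n\to\infty}\frac{\log G_n^f(Y,\varepsilon)}{\log n}$, and ${\rm h_{pol}}(f)={\rm h_{pol}}(f,X)$. The circle carries its standard metric. A rotation of $\mathbb T$ is a map $\bar x\mapsto \bar x+\bar a$. *)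

(* Defs.v *)
From HB Require Import structures.
From mathcomp Require Import all_boot all_order all_algebra.
From mathcomp Require Import all_classical all_reals all_analysis.
Set Implicit Arguments. Unset Strict Implicit. Unset Printing Implicit Defensive.
Import Order.TTheory GRing.Theory Num.Theory.
Import numFieldNormedType.Exports.
Local Open Scope classical_set_scope.
Local Open Scope ring_scope.

Section Entropy.
Variables (R : realType) (T : Type) (d : T -> T -> R) (f : T -> T).

Definition dyn_dist (n : nat) (x y : T) : R :=
  \big[Num.max/0]_(k < n) d (iter k f x) (iter k f y).

Definition covered_by (n : nat) (e : R) (k : nat) : Prop :=
  exists c : 'I_k -> T, forall y : T, exists i : 'I_k, dyn_dist n (c i) y < e.

(* G_n^f(T, e): minimal number of d_n-balls of radius e covering T
   (0 by convention if no finite cover exists, which never happens for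
   compact spaces). *)
Definition Gcov (n : nat) (e : R) : nat :=
  match pselect (exists k, covered_by n e k) with
  | left H => @ex_minn (fun k => `[< covered_by n e k >])
      (let: ex_intro k Hk := H in ex_intro _ k (asboolT Hk))
  | right _ => 0%N
  end.

Definition hpol_eps (e : R) : \bar R :=
  limn_esup (fun n => (ln (Gcov n e)%:R / ln n%:R)%:E).

Definition hpol : \bar R := lim (hpol_eps e @[e --> 0^'+]).

End Entropy.

Section Circle.
Variable R : realType.

Definition frac (x : R) : R := x - (Num.floor x)%:~R.

Lemma frac_range (x : R) : (0 <= frac x < 1).
Proof.
rewrite /frac subr_ge0 ltrBlDl; apply/andP; split.
  by rewrite floor_le.
by rewrite addrC -[X in X + _]/(1%:~R) -intrD addrC floorD1_gt.
Qed.

(* The circle T = R/Z, with points represented by their representative in [0,1). *)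
Definition circle := {x : R | (0 <= x < 1)}.

Definition toT (x : R) : circle := exist _ (frac x) (frac_range x).

Definition circ_dist (x y : circle) : R :=
  let t := `|sval x - sval y| in Num.min t (1 - t).

Definition circ_continuous (g : circle -> circle) : Prop :=
  forall (x : circle) (e : R), 0 < e ->
    exists2 del : R, 0 < del &
      forall y : circle, circ_dist x y < del -> circ_dist (g x) (g y) < e.

Definition circ_homeo (g : circle -> circle) : Prop :=
  exists h : circle -> circle,
    cancel g h /\ cancel h g /\ circ_continuous g /\ circ_continuous h.

Definition orientation_preserving (g : circle -> circle) : Prop :=
  exists F : R -> R, continuous F /\ {homo F : x y / x < y} /\
    forall x : R, g (toT x) = toT (F x).

Definition rotation (a : R) (x : circle) : circle := toT (sval x + a).

Definition conj_to_rotation (g : circle -> circle) : Prop :=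
  exists (h : circle -> circle) (a : R),
    circ_homeo h /\ forall x : circle, h (g x) = rotation a (h x).

End Circle.

(* Main.v *)
(* Counting. Between consecutive preimages of a 1/N-grid under f^0, ..., f^(n-1)
   the first n iterates move points by less than 1/N, so G_n = O(n).  If some
   point p stays at distance at least e from its strict forward orbit under some
   f^k, then the points f^(-ki) p with ki < n are separated, so n = O(G_n) and
   the polynomial entropy is 1.
   Otherwise every point is recurrent under every power of f. For a lift F: if
   F^k + m has a fixed point, recurrence forces F^k + m = id, and the average of
   id, F, ..., F^(k-1) conjugates F to a translation. If no F^k + m has a fixed
   point, Poincare's semiconjugacy H to the translation by t is continuous
   because the numbers k t + m accumulate at 0, and injective by recurrence.
   Finally, G_n is bounded for a conjugate of an isometry. *)
Require Import Defs.
From HB Require Import structures.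
From mathcomp Require Import all_boot all_order all_algebra.
From mathcomp Require Import all_classical all_reals all_analysis.
From mathcomp Require Import ring lra.
Import Order.TTheory GRing.Theory Num.Theory.
Import numFieldNormedType.Exports.
Local Open Scope ring_scope.

(** * The circle and its lifts *)

Section CircleDistance.
Context {R : realType}.
Implicit Types (x y z : R) (p q r : circle R) (m : int).

Lemma toT_sval p : toT (sval p) = p.
Proof.
case: p => x x01 /=; apply: eq_exist => /=.
have x0 : Num.floor x = 0 by apply: floor_def; rewrite add0r.
by rewrite /Defs.frac x0 subr0.
Qed.

Lemma toT_int x m : toT (x + m%:~R) = toT x.
Proof.
apply: eq_exist; rewrite /Defs.frac floorDrz ?intr_int //.
by rewrite intrKfloor intrD; lra.
Qed.

Lemma toT_eq x y : toT x = toT y -> exists m, y = x + m%:~R.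
Proof.
move=> /(congr1 sval) /=; rewrite /Defs.frac => xy.
by exists (Num.floor y - Num.floor x); rewrite intrB; lra.
Qed.

(** Replacing [x] and [y] by fractional parts changes [x - y] by an integer. Together with
    [circ_distE], this identifies [circ_dist] with the distance from [x - y] to the nearest
    integer. *)
Lemma circ_dist_le x y m : circ_dist (toT x) (toT y) <= `|x - y + m%:~R|.
Proof.
have /andP[x0 x1] := frac_range x; have /andP[y0 y1] := frac_range y.
rewrite /circ_dist /=.
have -> : x - y + m%:~R =
    Defs.frac x - Defs.frac y + (Num.floor x - Num.floor y + m)%:~R.
  by rewrite /Defs.frac intrD intrB; lra.
move: (Num.floor x - _ + _) => k.
have [k0|k0|->] := ltrgt0P k.
- have : (1 : R) <= k%:~R by rewrite ler1z.
  rewrite ge_min => ?; apply/orP.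
  case: ger0P => ?; [left; case: ger0P; lra | right; case: ger0P; lra].
- have : k%:~R <= (-1 : R) by rewrite -[-1]/((-1)%:~R) ler_int -ltzD1.
  rewrite ge_min => ?; apply/orP.
  case: ger0P => ?; [right; case: ger0P; lra | left; case: ger0P; lra].
- by rewrite addr0 ge_min lexx.
Qed.

Lemma circ_distE x y :
  exists m, circ_dist (toT x) (toT y) = `|x - y + m%:~R|.
Proof.
have /andP[x0 x1] := frac_range x; have /andP[y0 y1] := frac_range y.
rewrite /circ_dist /=.
suff [k ->] : exists k : int,
    Num.min `|Defs.frac x - Defs.frac y| (1 - `|Defs.frac x - Defs.frac y|) =
    `|Defs.frac x - Defs.frac y + k%:~R|.
  exists (k - (Num.floor x - Num.floor y)).
  by rewrite /Defs.frac !intrB; congr (`|_|); lra.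
rewrite /Num.min; case: ifP => _; first by exists 0; rewrite addr0.
have [?|?] := leP (Defs.frac x) (Defs.frac y).
  exists 1; rewrite ler0_norm; last lra.
  by rewrite ger0_norm; lra.
exists (- 1); rewrite rmorphN1 gtr0_norm; last lra.
by rewrite ler0_norm; lra.
Qed.

Lemma circ_dist_triangle p q r :
  circ_dist p r <= circ_dist p q + circ_dist q r.
Proof.
rewrite -(toT_sval p) -(toT_sval q) -(toT_sval r).
have [k ->] := circ_distE (sval p) (sval q).
have [l ->] := circ_distE (sval q) (sval r).
apply: le_trans (circ_dist_le _ _ (k + l)) _.
apply: le_trans _ (ler_normD _ _).
by rewrite intrD le_eqVlt; apply/orP; left; apply/eqP; congr (`|_|); lra.
Qed.

Lemma circ_distC p q : circ_dist p q = circ_dist q p.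
Proof. by rewrite /circ_dist distrC. Qed.

End CircleDistance.

(* [G] is carried along as the inverse of [F], so that the lifts of
   orientation preserving homeomorphisms and of their inverses are treated
   symmetrically. *)
Definition circle_lift {R : realType} (F G : R -> R) : Prop :=
  [/\ {homo F : x y / x < y}, forall x, F (x + 1) = F x + 1,
      cancel F G & cancel G F].

Lemma can_iter {T : Type} {f g : T -> T} k :
  cancel f g -> cancel (iter k f) (iter k g).
Proof. by move=> fK; elim: k => // k IH x; rewrite iterSr iterS fK IH. Qed.

Section Lifts.
Context {R : realType}.
Implicit Types (F G H K : R -> R) (x y z : R) (m : int).

Lemma circle_lift_sym {F G} : circle_lift F G -> circle_lift G F.
Proof.
case=> Fhomo F1 FK GK; split=> //.
  move=> x y xy; rewrite ltNge; apply/negP; rewrite le_eqVlt => /orP[/eqP|].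
    by move=> /(can_inj GK) yx; rewrite yx ltxx in xy.
  by move=> /Fhomo; rewrite !GK ltNge (ltW xy).
by move=> x; rewrite -{1}[x]GK -F1 FK.
Qed.

Lemma lift_lt {F G} : circle_lift F G -> {mono F : x y / x < y}.
Proof.
by case=> Fhomo _ _ _; apply: leW_mono; apply: le_mono => x y; exact: Fhomo.
Qed.

Lemma lift_le {F G} : circle_lift F G -> {mono F : x y / x <= y}.
Proof. by case=> Fhomo _ _ _; apply: le_mono => x y; exact: Fhomo. Qed.

(** Kept general because it is applied to Poincare's semiconjugacy before that map is known to be
    invertible. *)
Lemma equivariant_int {F} : (forall x, F (x + 1) = F x + 1) ->
  forall x m, F (x + m%:~R) = F x + m%:~R.
Proof.
move=> F1.
have Fn x (n : nat) : F (x + n%:R) = F x + n%:R.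
  elim: n x => [|n IH] x; first by rewrite !addr0.
  by rewrite -natr1 addrA F1 IH addrA.
move=> x [n|n]; first exact: Fn.
rewrite NegzE mulrNz; apply: (addIr n.+1%:R).
by rewrite -Fn -!pmulrn !subrK.
Qed.

Lemma lift_int {F G} : circle_lift F G ->
  forall x m, F (x + m%:~R) = F x + m%:~R.
Proof. by case=> _ F1 _ _; exact: equivariant_int. Qed.

Lemma circle_lift_trans {F G} k m : circle_lift F G ->
  circle_lift (fun x => iter k F x + m%:~R) (fun x => iter k G (x - m%:~R)).
Proof.
move=> FG; split.
- move=> x y xy; rewrite ltrD2r.
  by elim: k => //= k; rewrite (lift_lt FG).
- move=> x; rewrite addrAC; congr (_ + _).
  by elim: k => //= k ->; case: FG.
- by move=> x; rewrite addrK; case: FG => _ _ FK _; exact: can_iter.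
- by move=> x; case: FG => _ _ _ GK; rewrite (can_iter _ GK) subrK.
Qed.

Lemma circle_lift_iter {F G} k : circle_lift F G ->
  circle_lift (iter k F) (iter k G).
Proof.
move=> /(circle_lift_trans k 0); congr circle_lift.
  by apply/funext => x; rewrite addr0.
by apply/funext => x; rewrite subr0.
Qed.

(** The translate [y + m + 1] lies between [x] and [x + 1]; monotonicity of [F] at [x] and at this
    translate compares the displacements. *)
Lemma lift_disp {F G} : circle_lift F G ->
  forall x y, F x - x <= F y - y + 1.
Proof.
move=> FG x y.
have := floorD1_gt (x - y); have := floor_le (x - y).
set m := Num.floor _ => m1 m2.
have : F x <= F (y + (m + 1)%:~R).
  by rewrite (lift_le FG); lra.
by rewrite (lift_int FG) intrD; lra.
Qed.

End Lifts.

(** * Continuity of lifts and the circle maps they induce *)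

Section LiftContinuity.
Context {R : realType}.
Implicit Types (F G H K : R -> R) (x y z : R) (m : int) (f : circle R -> circle R).

(** An increasing bijection is continuous: [G (F x - e)] and [G (F x + e)] enclose [x], and [F]
    stays within [e] of [F x] between them. *)
Lemma lift_modulus {F G} : circle_lift F G -> forall x e, 0 < e ->
  exists2 d, 0 < d & forall y, `|x - y| < d -> `|F x - F y| < e.
Proof.
move=> FG x e e0; have GF := circle_lift_sym FG.
have FK : cancel F G by case: FG.
have lb : G (F x - e) < x by rewrite -{2}(FK x) (lift_lt GF); lra.
have ub : x < G (F x + e) by rewrite -{1}(FK x) (lift_lt GF); lra.
exists (Num.min (x - G (F x - e)) (G (F x + e) - x)).
  by rewrite lt_min; lra.
move=> y; rewrite lt_min !ltr_norml => /andP[/andP[? ?] /andP[? ?]].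
have GK : cancel G F by case: FG.
have : F (G (F x - e)) < F y by rewrite (lift_lt FG); lra.
have : F y < F (G (F x + e)) by rewrite (lift_lt FG); lra.
by rewrite !GK; lra.
Qed.

Lemma lift_continuous {F G} : circle_lift F G -> continuous F.
Proof.
move=> FG x; apply/cvgrPdist_lt => e /(lift_modulus FG x)[d d0 dP].
by apply/nbhs_ballP; exists d => // y; exact: dP.
Qed.

Lemma continuous_lift {F} : continuous F -> {homo F : x y / x < y} ->
  (forall x, F (x + 1) = F x + 1) -> exists G, circle_lift F G.
Proof.
move=> Fc Fhomo F1.
have Fint x (n : nat) : F (x + n%:R) = F x + n%:R.
  exact: (equivariant_int F1 x n).
have Fsurj y : exists x, F x = y.
  (* With this [n], [y] lies between [F (- n) = F 0 - n] and [F n = F 0 + n]. *)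
  pose n := Num.bound (`|y| + `|F 0|).
  have nP : `|y| + `|F 0| < n%:R by apply: archi_boundP; rewrite addr_ge0.
  have Fn : F n%:R = F 0 + n%:R by rewrite -[n%:R in LHS]add0r Fint.
  have FNn : F (- n%:R) = F 0 - n%:R.
    by apply: (addIr n%:R); rewrite subrK -Fint addNr.
  have n0 : 0 <= n%:R :> R by [].
  have /= [|||x _ <-] := @IVT R F (- n%:R) n%:R y.
  - lra.
  - exact: continuous_subspaceT.
  - rewrite FNn Fn min_l ?max_r; move: nP;
    by case: (ger0P y); case: (ger0P (F 0)); lra.
  - by exists x.
have [G GK] := choice Fsurj.
by exists G; split=> // x; apply: (inc_inj (le_mono Fhomo)); rewrite GK.
Qed.

(** Injectivity forces degree one: [F (x + 1) - F x] is a positive integer, and if it exceeded 1,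
    [F] would take the value [F x + 1] strictly between [x] and [x + 1], so that two circle points
    would share an image. *)
Lemma lift_of_injective f F : injective f -> continuous F ->
  {homo F : x y / x < y} -> (forall x, f (toT x) = toT (F x)) ->
  exists G, circle_lift F G.
Proof.
move=> finj Fc Fhomo fF; apply: (continuous_lift Fc Fhomo) => x.
have [m Fm] : exists m : int, F (x + 1) = F x + m%:~R.
  by apply: toT_eq; rewrite -!fF -(toT_int x 1).
have m0 : 0 < m by rewrite -(ltr0z R); have := Fhomo x (x + 1); lra.
have [m1|] := leP m 1.
  have m_eq1 : m = 1 by apply/eqP; rewrite eq_le m1 -gtz0_ge1.
  by rewrite Fm m_eq1.
rewrite -(ltr_int R) => m1.
have /= [|||y] := @IVT R F x (x + 1) (F x + 1).
- lra.
- exact: continuous_subspaceT.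
- by rewrite Fm min_l ?max_r; lra.
rewrite in_itv /= => /andP[xy yx] Fy.
have /toT_eq[k yk] : toT x = toT y by apply: finj; rewrite !fF Fy (toT_int _ 1).
have [k1|k1] := leP k 0.
  have : k%:~R <= (0 : R) by rewrite lerz0.
  by move=> ?; have yx' : y = x; [lra|move: Fy; rewrite yx'; lra].
have : (1 : R) <= k%:~R by rewrite ler1z -gtz0_ge1.
by move=> ?; have yx' : y = x + 1; [lra|move: Fy; rewrite yx'; lra].
Qed.

Definition induced (F : R -> R) : circle R -> circle R :=
  fun p => toT (F (sval p)).

Lemma inducedE {F G} : circle_lift F G ->
  forall x, induced F (toT x) = toT (F x).
Proof.
move=> FG x; rewrite /induced /= /Defs.frac -mulrNz (lift_int FG).
by rewrite toT_int.
Qed.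

Lemma induced_can {F G} : circle_lift F G -> cancel (induced F) (induced G).
Proof.
move=> FG p; rewrite /induced -[in LHS]/(induced G _).
rewrite (inducedE (circle_lift_sym FG)).
by case: FG => _ _ -> _; rewrite toT_sval.
Qed.

Lemma induced_continuous {F G} : circle_lift F G ->
  circ_continuous (induced F).
Proof.
move=> FG p e e0; have [d d0 dP] := lift_modulus FG (sval p) _ e0.
exists d => // q; rewrite -{1}(toT_sval p) -{1}(toT_sval q).
have [m ->] := circ_distE (sval p) (sval q) => pq.
apply: le_lt_trans (circ_dist_le _ _ m) _.
have := dP (sval q - m%:~R).
rewrite -mulrNz (lift_int FG) !opprD -!mulrNz opprK !addrA.
exact.
Qed.

Lemma induced_homeo {F G} : circle_lift F G -> circ_homeo (induced F).
Proof.
move=> FG; have GF := circle_lift_sym FG; exists (induced G).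
by do !split; [exact: induced_can FG|exact: induced_can GF|
  exact: induced_continuous FG|exact: induced_continuous GF].
Qed.

Lemma conj_of_lift {f F H K} a : (forall x, f (toT x) = toT (F x)) ->
  circle_lift H K -> (forall x, H (F x) = H x + a) -> conj_to_rotation f.
Proof.
move=> fF HK HF; exists (induced H), a; split; first exact: induced_homeo HK.
move=> p; rewrite -(toT_sval p) fF !(inducedE HK) HF /rotation /=.
by rewrite /Defs.frac -mulrNz addrAC toT_int.
Qed.

End LiftContinuity.

(** * Translation number *)

Section TranslationNumber.
Context {R : realType}.
Implicit Types (F G T : R -> R) (x y z : R) (m : int).

Lemma iter_trans {F G} : circle_lift F G -> forall i k m x,
  iter i (fun x => iter k F x + m%:~R) x = iter (i * k) F x + i%:R * m%:~R.
Proof.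
move=> FG i k m x; elim: i => [|i IH]; first by rewrite mul0r addr0.
rewrite iterS IH mulSn iterD.
have := lift_int (circle_lift_iter k FG) (iter (i * k) F x) (i%:Z * m).
by rewrite intrM => ->; rewrite -natr1; lra.
Qed.

Lemma iter_disp {F G} : circle_lift F G -> forall n,
  n%:R * (F 0 - 1) <= iter n F 0 <= n%:R * (F 0 + 1).
Proof.
move=> FG; elim=> [|n /andP[IH1 IH2]]; first by rewrite !mul0r lexx.
have := lift_disp FG 0 (iter n F 0); have := lift_disp FG (iter n F 0) 0.
by rewrite iterS -natr1; lra.
Qed.

(** Reading [F^(kl) 0] as a [k]-fold and as an [l]-fold iterate gives
    [(a k - 1) / k <= (a l + 1) / l], so one number [t] separates all these ratios. The error is at
    most 1 at the point 0, and [lift_disp] adds 1 for any other point. *)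
Lemma translation_number {F G} : circle_lift F G ->
  exists t : R, forall k x, `|iter k F x - x - k%:R * t| <= 2.
Proof.
move=> FG; pose a k := iter k F 0.
have ak k l : l%:R * (a k - 1) <= k%:R * (a l + 1).
  have /andP[+ _] := iter_disp (circle_lift_iter k FG) l.
  have /andP[_ +] := iter_disp (circle_lift_iter l FG) k.
  by rewrite -!iterM mulnC -!/(a _); lra.
pose E := [set u : R | exists2 k, (0 < k)%N & u = (a k - 1) / k%:R]%classic.
have Eub l : (0 < l)%N -> ubound E ((a l + 1) / l%:R).
  move=> l0 _ [k k0 ->].
  by rewrite ler_pdivrMr ?ltr0n // mulrAC ler_pdivlMr ?ltr0n // mulrC
     [leRHS]mulrC ak.
have E1 : has_sup E.
  split; first by exists ((a 1%N - 1) / 1%:R); exists 1%N.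
  by exists ((a 1%N + 1) / 1%:R); exact: Eub.
exists (sup E) => k x.
have [->|k0] := posnP k; first by rewrite /= subrr mul0r subr0 normr0.
have lo : a k - 1 <= k%:R * sup E.
  rewrite mulrC -ler_pdivrMr ?ltr0n //.
  by apply: (sup_upper_bound E1); exists k.
have hi : k%:R * sup E <= a k + 1.
  rewrite mulrC -ler_pdivlMr ?ltr0n //.
  by apply: ge_sup; [case: E1|exact: Eub].
have := lift_disp (circle_lift_iter k FG) 0 x.
have := lift_disp (circle_lift_iter k FG) x 0.
rewrite -/(a k) ler_norml; lra.
Qed.

(* The supremum of a full orbit, which is permuted by [F], is fixed. *)
Lemma bounded_disp_fixpoint {F G} (C : R) : circle_lift F G ->
  (forall i x, `|iter i F x - x| <= C) -> exists p, F p = p.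
Proof.
move=> FG dispF; have GF := circle_lift_sym FG.
have [_ _ FK GK] := FG.
pose E := [set u | exists i j, u = iter j G (iter i F 0)]%classic.
have EF u : E u -> E (F u).
  case=> i [[|j] ->]; first by exists i.+1, 0%N.
  by exists i, j; rewrite iterS GK.
have EG u : E u -> E (G u) by case=> i [j ->]; exists i, j.+1.
have E1 : has_sup E.
  split; first by exists 0; exists 0%N, 0%N.
  exists (C + C) => _ [i [j ->]].
  have := dispF j (iter j G (iter i F 0)); rewrite (can_iter _ GK).
  by have := dispF i 0; rewrite !ler_norml; lra.
exists (sup E); apply/eqP; rewrite eq_le; apply/andP; split.
  rewrite -(lift_le GF) FK; apply: ge_sup; first by case: E1.
  by move=> u /EF Eu; rewrite -(lift_le FG) GK; exact: sup_upper_bound.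
apply: ge_sup; first by case: E1.
by move=> u /EG Eu; rewrite -(lift_le GF) FK; exact: sup_upper_bound.
Qed.

(** When [k t + m = 0], the [i]-th iterate of [F^k + m] displaces [x] by [F^(ik) x - x - i k t],
    which is bounded by 2 for all [i]. *)
Lemma zero_displacement_fixpoint {F G} {t : R} : circle_lift F G ->
  (forall k x, `|iter k F x - x - k%:R * t| <= 2) ->
  forall k m, k%:R * t + m%:~R = 0 -> exists p, iter k F p + m%:~R = p.
Proof.
move=> FG tP k m km.
apply: (bounded_disp_fixpoint 2 (circle_lift_trans k m FG)) => i x.
rewrite (iter_trans FG).
have := tP (i * k)%N x; rewrite natrM -mulrA.
have -> : k%:R * t = - m%:~R by lra.
by congr (`|_| <= _); lra.
Qed.

(** Pigeonhole: the fractional parts of [0, t, ..., (n + 1) t] fall into [n + 1] boxes of length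
    [1 / (n + 1)], and two in one box give [k] as the difference of their indices. *)
Lemma dirichlet (t : R) (n : nat) : exists k (m : int), (0 < k)%N /\
  `|k%:R * t + m%:~R| < n.+1%:R^-1.
Proof.
pose u i : R := Defs.frac (i%:R * t).
have u01 i : 0 <= u i < 1 by exact: frac_range.
have n0 : 0 < n.+1%:R :> R by [].
pose c (i : 'I_n.+2) : 'I_n.+1 := inord (Num.trunc (n.+1%:R * u i)).
have cE i : (c i)%:R <= n.+1%:R * u i < (c i)%:R + 1.
  have /andP[ui0 ui1] := u01 i.
  have nu0 : 0 <= n.+1%:R * u i by rewrite mulr_ge0.
  rewrite inordK; first by rewrite natr1 truncn_itv.
  by rewrite truncn_lt_nat // gtr_pMr.
have : ~~ injectiveb c.
  apply/negP => /injectiveP /leq_card; by rewrite !card_ord ltnn.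
move=> /injectivePn[i0 [j0 ij0 cij0]].
have [i [j [ij cij]]] : exists i j : 'I_n.+2, (i < j)%N /\ c i = c j.
  move: ij0; rewrite -val_eqE neq_ltn => /orP[?|?].
    by exists i0, j0.
  by exists j0, i0.
exists (j - i)%N, (Num.floor (i%:R * t) - Num.floor (j%:R * t)).
split; first by rewrite subn_gt0.
rewrite natrB 1?ltnW // intrB.
have -> : (j%:R - i%:R) * t + ((Num.floor (i%:R * t))%:~R -
    (Num.floor (j%:R * t))%:~R) = u j - u i.
  by rewrite /u /Defs.frac; lra.
rewrite -[ltRHS]mul1r ltr_pdivlMr // -(gtr0_norm n0) -normrM.
have := cE i; have := cE j; rewrite cij ltr_norml; lra.
Qed.

End TranslationNumber.

(** * Conjugation of recurrent lifts to translations *)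

Section Linearization.
Context {R : realType}.
Implicit Types (F G H K : R -> R) (x y z : R) (m : int).

Definition lift_conj_to_translation F : Prop :=
  exists H K t, circle_lift H K /\ forall x, H (F x) = H x + t.

Lemma periodic_linearization {F G} k m : circle_lift F G -> (0 < k)%N ->
  (forall x, iter k F x + m%:~R = x) -> lift_conj_to_translation F.
Proof.
move=> FG k0 Fk; have k0R : 0 < k%:R :> R by rewrite ltr0n.
pose H x := (\sum_(i < k) iter i F x) / k%:R.
have HF x : H (F x) = H x - m%:~R / k%:R.
  rewrite /H -mulrBl; congr (_ / _).
  (* Splitting this sum at either end shows that passing from [x] to [F x] changes the sum in [H] by
     [F^k x - x = - m]. *)
  have : \sum_(i < k.+1) iter i F x = \sum_(i < k) iter i F x + iter k F x.
    by rewrite big_ord_recr.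
  rewrite big_ord_recl /=; under eq_bigr do rewrite -iterS iterSr.
  by have := Fk x; lra.
have H1 x : H (x + 1) = H x + 1.
  rewrite /H -[X in _ = _ + X](mulfV (lt0r_neq0 k0R)) -mulrDl.
  congr (_ / _).
  have -> : k%:R = \sum_(i < k) (1 : R).
    by rewrite sumr_const card_ord.
  rewrite -big_split /=; apply: eq_bigr => i _.
  exact: (lift_int (circle_lift_iter i FG) x 1).
have Hhomo : {homo H : x y / x < y}.
  move=> x y xy; rewrite /H ltr_pM2r ?invr_gt0 //.
  apply: ltr_sum; last by move=> i _; rewrite (lift_lt (circle_lift_iter i FG)).
  by apply/hasP; exists (Ordinal k0) => //; rewrite mem_index_enum.
have Hc : continuous H.
  move=> x; apply: cvgMr_tmp; apply: cvg_big => [|i _].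
    exact: add_continuous.
  exact: (lift_continuous (circle_lift_iter i FG)).
have [K HK] := continuous_lift Hc Hhomo H1.
by exists H, K, (- (m%:~R / k%:R)).
Qed.

(* Poincare's semiconjugacy: [x |-> sup_(n in Z) (F^n x - n t)]. *)
Lemma poincare_semiconjugacy {F G} (t : R) : circle_lift F G ->
  (forall k x, `|iter k F x - x - k%:R * t| <= 2) ->
  exists H, [/\ {homo H : x y / x <= y}, forall x, H (x + 1) = H x + 1 &
    forall x, H (F x) = H x + t].
Proof.
move=> FG tP; have GF := circle_lift_sym FG; have [_ _ FK GK] := FG.
(* The pair [(i, j)] encodes the exponent [i - j] in Z. *)
pose S x := [set u | exists i j : nat,
  u = iter j G (iter i F x) - i%:R * t + j%:R * t]%classic.
have S1 x : has_sup (S x).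
  split; first by exists (iter 0 G (iter 0 F x) - 0%:R * t + 0%:R * t), 0%N, 0%N.
  (* The forward and the backward iterates each contribute an error of at most 2. *)
  exists (x + 4) => _ [i [j ->]].
  have := tP j (iter j G (iter i F x)); rewrite (can_iter _ GK).
  by have := tP i x; rewrite !ler_norml; lra.
have supS x y c : (forall u, S x u -> exists2 v, S y v & u + c <= v) ->
    sup (S x) + c <= sup (S y).
  move=> xy; rewrite -lerBrDr; apply: ge_sup; first by case: (S1 x).
  move=> u /xy[v Sv uv]; rewrite lerBrDr; apply: le_trans uv _.
  exact: sup_upper_bound.
exists (fun x => sup (S x)); split.
- move=> x y xy; rewrite -[leLHS]addr0; apply: supS => _ [i [j ->]].
  exists (iter j G (iter i F y) - i%:R * t + j%:R * t); first by exists i, j.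
  rewrite addr0 !lerD2r.
  by rewrite (lift_le (circle_lift_iter j GF)) (lift_le (circle_lift_iter i FG)).
- have shift x m i j : iter j G (iter i F (x + m%:~R)) =
      iter j G (iter i F x) + m%:~R.
    by rewrite (lift_int (circle_lift_iter i FG))
      (lift_int (circle_lift_iter j GF)).
  move=> x; apply/eqP; rewrite eq_le -lerBlDr; apply/andP; split.
    apply: supS => _ [i [j ->]].
    exists (iter j G (iter i F x) - i%:R * t + j%:R * t); first by exists i, j.
    by rewrite (shift x 1); lra.
  apply: supS => _ [i [j ->]].
  exists (iter j G (iter i F (x + 1)) - i%:R * t + j%:R * t).
    by exists i, j.
  by rewrite (shift x 1); lra.
- move=> x; apply/eqP; rewrite eq_le -lerBlDr; apply/andP; split.
    apply: supS => _ [i [j ->]].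
    exists (iter j G (iter i.+1 F x) - i.+1%:R * t + j%:R * t).
      by exists i.+1, j.
    by rewrite iterSr -natr1; lra.
  (* One more [G] cancels the extra [F], so the orbit point is unchanged while its weight gains
     [t]. *)
  apply: supS => _ [i [j ->]].
  exists (iter j.+1 G (iter i F (F x)) - i%:R * t + j.+1%:R * t).
    by exists i, j.+1.
  by rewrite [iter j.+1 G _]iterSr -(iterSr i F) iterS FK -natr1; lra.
Qed.

Lemma aperiodic_linearization {F G} : circle_lift F G ->
  (forall k m x, (0 < k)%N -> iter k F x + m%:~R <> x) ->
  (forall x e, 0 < e -> exists k m, (0 < k)%N /\
     `|iter k F x + m%:~R - x| < e) ->
  lift_conj_to_translation F.
Proof.
move=> FG aper recF; have [t tP] := translation_number FG.
have [H [Hle H1 HF]] := poincare_semiconjugacy t FG tP.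
have HT k m x : H (iter k F x + m%:~R) = H x + (k%:R * t + m%:~R).
  rewrite (equivariant_int H1) addrA; congr (_ + _).
  elim: k => [|k IH]; first by rewrite mul0r addr0.
  by rewrite iterS HF IH -natr1; lra.
have disp0 k m : (0 < k)%N -> k%:R * t + m%:~R != 0.
  move=> k0; apply/eqP => /(zero_displacement_fixpoint FG tP)[p].
  exact: aper.
(* Weak monotonicity of [H] gives only a weak sign for [k t + m]; since this number is nonzero, its
   sign is the direction in which [F^k + m] moves any point. *)
have disp_gt0 k m x : (0 < k)%N -> x < iter k F x + m%:~R ->
    0 < k%:R * t + m%:~R.
  by move=> k0 /ltW/Hle; rewrite HT lt_def disp0 //; lra.
have disp_lt0 k m x : (0 < k)%N -> iter k F x + m%:~R < x ->
    k%:R * t + m%:~R < 0.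
  by move=> k0 /ltW/Hle; rewrite HT lt_def eq_sym disp0 //; lra.
(* The midpoint [z] of [x, y] returns to [x, y]: whichever side it returns to,
   [H] takes different values at [z] and at its return. *)
have Hhomo : {homo H : x y / x < y}.
  move=> x y xy; pose z := (x + y) / 2.
  have d0 : 0 < (y - x) / 2 by lra.
  have [k [m [k0]]] := recF z _ d0; rewrite ltr_norml => /andP[zl zr].
  have [zT|Tz|/esym/aper] := ltgtP z (iter k F z + m%:~R); last by [].
    have : H (iter k F z + m%:~R) <= H y by apply: Hle; rewrite /z in zr *; lra.
    have : H x <= H z by apply: Hle; rewrite /z; lra.
    by have := disp_gt0 _ _ _ k0 zT; rewrite HT; lra.
  have : H x <= H (iter k F z + m%:~R) by apply: Hle; rewrite /z in zl *; lra.
  have : H z <= H y by apply: Hle; rewrite /z; lra.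
  by have := disp_lt0 _ _ _ k0 Tz; rewrite HT; lra.
(* [T = F^k + m] satisfies [H (T y) = H y + s] with [|s| < e], so [H] varies
   by at most [e] between [x] and its neighbours [T x] and [T^-1 x]. *)
have Hmod (x e : R) : 0 < e -> exists a b : R,
    [/\ a < x, x < b, H x - e <= H a & H b <= H x + e].
  move=> e0; pose n := Num.bound e^-1.
  have ne : n.+1%:R^-1 <= e.
    rewrite invf_ple ?posrE // ltW // (lt_trans (archi_boundP _)) //.
      by rewrite invr_ge0 ltW.
    by rewrite ltr_nat.
  have [k [m [k0 km]]] := dirichlet t n.
  have TT := circle_lift_trans k m FG; have [_ _ _ TK] := TT.
  set T := (fun y => _ + _) in TT TK; set T' := (fun y => _) in TT TK.
  have HTx y : H (T y) = H y + (k%:R * t + m%:~R) by exact: HT.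
  have HTx0 := HTx x.
  have Hw : H x = H (T' x) + (k%:R * t + m%:~R) by rewrite -HTx TK.
  move: (lt_le_trans km ne); rewrite ltr_norml => /andP[? ?].
  have [xT|Tx|/esym/aper] := ltgtP x (T x); last by [].
    exists (T' x), (T x); split; [|by []|lra|lra].
    by rewrite -(lift_lt TT) TK.
  exists (T x), (T' x); split; [by []| |lra|lra].
  by rewrite -(lift_lt TT) TK.
have Hc : continuous H.
  move=> x; apply/cvgrPdist_le => e /(Hmod x)[a [b [ax xb Ha Hb]]].
  near=> y.
  have ay : a <= y by apply/ltW; near: y; exact: lt_nbhsr.
  have yb : y <= b by apply/ltW; near: y; exact: lt_nbhsl.
  move: (Hle _ _ ay) (Hle _ _ yb) => ? ?.
  by rewrite ler_norml; apply/andP; split; lra.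
have [K HK] := continuous_lift Hc Hhomo H1.
by exists H, K, t.
Unshelve. all: by end_near. Qed.

End Linearization.

(** * From recurrence to conjugacy with a rotation *)

Section Recurrence.
Context {R : realType}.
Implicit Types (F G T : R -> R) (x y z : R) (m : int) (f : circle R -> circle R).

Lemma iter_lift {f F} : (forall x, f (toT x) = toT (F x)) ->
  forall k x, iter k f (toT x) = toT (iter k F x).
Proof. by move=> fF; elim=> //= k IH x; rewrite IH fF. Qed.

(** The fixed points [a] and [a + 1] trap every orbit starting between them. If [T x] differs from
    [x], the orbit is monotone and stays at least [|T x - x|] away from [x], against recurrence. *)
Lemma recurrent_fixpoint_id {T T'} a : circle_lift T T' -> T a = a ->
  (forall x e, 0 < e -> exists j m, (0 < j)%N /\
     `|iter j T x - x + m%:~R| < e) ->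
  forall x, T x = x.
Proof.
move=> TT Ta recT.
have bounds j x : a < x -> x < a + 1 -> a < iter j T x < a + 1.
  move=> ax xa; have Tj := circle_lift_iter j TT.
  have ja : iter j T a = a by elim: j {Tj} => //= j ->.
  have ja1 : iter j T (a + 1) = a + 1 by rewrite (lift_int Tj a 1) ja.
  by rewrite -{1}ja -ja1 !(lift_lt Tj) ax xa.
have near_eq0 m (e d : R) : -1 < d -> d < 1 -> e <= 1 + d -> e <= 1 - d ->
    `|d + m%:~R| < e -> `|d| < e.
  move=> d1 d2 e1 e2; rewrite ltr_norml => /andP[dl dr].
  have [m0|m0|m0] := ltrgt0P m.
  - have : (1 : R) <= m%:~R by rewrite ler1z -gtz0_ge1.
    lra.
  - have : m%:~R <= (-1 : R) by rewrite -[-1]/((-1)%:~R) ler_int -ltzD1.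
    lra.
  - by move: dl dr; rewrite m0 addr0 ltr_norml => -> ->.
have iter_le x j : T x <= x -> (0 < j)%N -> iter j T x <= T x.
  move=> Tx; case: j => // j _; elim: j => // j IH.
  by rewrite iterS (lift_le TT) (le_trans IH).
have iter_ge x j : x <= T x -> (0 < j)%N -> T x <= iter j T x.
  move=> xT; case: j => // j _; elim: j => // j IH.
  by rewrite [leRHS]iterS (lift_le TT) (le_trans xT).
have Tfix x : a < x -> x < a + 1 -> T x = x.
  move=> ax xa; have [Tx|xT|//] := ltgtP (T x) x.
  - have e0 : 0 < Num.min (x - T x) (a + 1 - x) by rewrite lt_min; lra.
    have [j [m [j0 jm]]] := recT x _ e0.
    have /andP[? ?] := bounds j x ax xa; have /andP[? ?] := bounds 1%N x ax xa.
    have ? := iter_le x j (ltW Tx) j0.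
    move: e0 jm; set e := Num.min _ _ => e0 jm.
    have [? ?] : e <= x - T x /\ e <= a + 1 - x.
      by rewrite !ge_min !lexx orbT.
    suff : `|iter j T x - x| < e by rewrite ltr_norml; lra.
    by apply: (near_eq0 m) => //; simpl in *; lra.
  - have e0 : 0 < Num.min (T x - x) (x - a) by rewrite lt_min; lra.
    have [j [m [j0 jm]]] := recT x _ e0.
    have /andP[? ?] := bounds j x ax xa; have /andP[? ?] := bounds 1%N x ax xa.
    have ? := iter_ge x j (ltW xT) j0.
    move: e0 jm; set e := Num.min _ _ => e0 jm.
    have [? ?] : e <= T x - x /\ e <= x - a.
      by rewrite !ge_min !lexx orbT.
    suff : `|iter j T x - x| < e by rewrite ltr_norml; lra.
    by apply: (near_eq0 m) => //; simpl in *; lra.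
move=> x; set m := Num.floor (x - a).
suff : T (x - m%:~R) = x - m%:~R.
  by rewrite -mulrNz (lift_int TT) => /addIr.
have := floor_le (x - a); have := floorD1_gt (x - a); rewrite -/m intrD => ? ?.
have [->//|xa] := eqVneq (x - m%:~R) a.
by apply: Tfix; [rewrite lt_def xa; lra|lra].
Qed.

Lemma recurrent_conj {f F G} : circle_lift F G ->
  (forall x, f (toT x) = toT (F x)) ->
  (forall k p e, (0 < k)%N -> 0 < e ->
     exists2 j, (0 < j)%N & circ_dist (iter (k * j) f p) p < e) ->
  conj_to_rotation f.
Proof.
move=> FG fF recf.
have recF k x e : (0 < k)%N -> 0 < e -> exists j m, (0 < j)%N /\
    `|iter (k * j) F x - x + m%:~R| < e.
  move=> k0 /(recf k (toT x) e k0)[j j0]; rewrite (iter_lift fF).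
  by have [m ->] := circ_distE (iter (k * j) F x) x; exists j, m.
suff [H [K [t [HK HF]]]] : lift_conj_to_translation F.
  exact: (conj_of_lift t fF HK HF).
have [[k [m [a [k0 Fa]]]]|aper] := pselect (exists k m a,
    (0 < k)%N /\ iter k F a + m%:~R = a).
  apply: (periodic_linearization k m FG k0).
  apply: (recurrent_fixpoint_id a (circle_lift_trans k m FG) Fa) => x e e0.
  have [j [l [j0 jl]]] := recF k x e k0 e0.
  (* The [j]-th iterate of [F^k + m] is [F^(jk) + j m], so [j m] is removed from the integer [l]. *)
  exists j, (l - j%:Z * m); split=> //.
  rewrite (iter_trans FG) mulnC intrB intrM.
  by apply: le_lt_trans jl; rewrite le_eqVlt; apply/orP; left; apply/eqP;
    congr (`|_|); lra.
apply: (aperiodic_linearization FG) => [k m x k0 Fx|x e e0].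
  by apply: aper; exists k, m, x.
have [j [m [j0 jm]]] := recF 1%N x e isT e0.
by exists j, m; split=> //; move: jm; rewrite mul1n addrAC.
Qed.

End Recurrence.

(** * Covers and separated sets *)

Section Covers.
Context {R : realType} {T : Type}.
Context (d : T -> T -> R) (f : T -> T).
Implicit Types (n k : nat) (e : R) (x y : T).

Lemma dyn_dist_lt n x y e : 0 < e ->
  (forall k, (k < n)%N -> d (iter k f x) (iter k f y) < e) ->
  dyn_dist d f n x y < e.
Proof. by move=> e0 dn; apply/bigmax_ltP; split=> // k _; exact: dn. Qed.

Lemma dyn_dist_ltE n x y e : dyn_dist d f n x y < e ->
  forall k, (k < n)%N -> d (iter k f x) (iter k f y) < e.
Proof. by move=> /bigmax_ltP[_ dn] k kn; exact: (dn (Ordinal kn)). Qed.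

Lemma GcovP n k e : Defs.covered_by d f n e k ->
  Defs.covered_by d f n e (Gcov d f n e) /\ (Gcov d f n e <= k)%N.
Proof.
move=> cov; rewrite /Gcov; case: pselect => [ex|[]]; last by exists k.
case: ex_minnP => l /asboolP covl minl; split=> //.
by apply: minl; exact/asboolP.
Qed.

(** The constant [C] perturbs the quotient of logarithms by at most [ln C / ln n], which tends to 0;
    the quotient converges, so its limsup is the limit. *)
Lemma hpol_epsE e (a C : nat) : (0 < C)%N ->
  (forall n, (1 < n)%N -> (n ^ a <= C * Gcov d f n e)%N /\
     (Gcov d f n e <= C * n ^ a)%N) ->
  hpol_eps d f e = a%:R%:E.
Proof.
move=> C0 growth; apply: (cvg_limn_einf_sup _).2.
apply: cvg_EFin; first exact: nearW.
apply/cvgrPdist_le => r r0; near=> n.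
have n1 : (1 < n)%N by near: n; exact: nbhs_infty_gt.
have [lo hi] := growth n n1.
have n0 : (0 < n)%N by exact: ltn_trans n1.
have G0 : (0 < Gcov d f n e)%N.
  by move: lo; case: Gcov => //; rewrite muln0 leqn0 expn_eq0 gtn_eqF.
have posn k : (0 < k)%N -> k%:R \is @Num.pos R by rewrite posrE ltr0n.
have lnn0 : 0 < ln n%:R :> R by rewrite ln_gt0 // ltr1n.
have lnna : ln (n ^ a)%:R = a%:R * ln n%:R :> R.
  by rewrite natrX lnXn ?ltr0n // mulr_natl.
have Cn : ln C%:R <= r * ln n%:R :> R.
  rewrite mulrC -ler_pdivrMr // -ler_expR lnK ?posn //.
  by near: n; exact: nbhs_infty_ger.
have lnlo : a%:R * ln n%:R <= ln C%:R + ln (Gcov d f n e)%:R :> R.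
  by rewrite -lnM ?posn // -natrM -lnna ler_ln ?posn ?ler_nat ?muln_gt0
    ?expn_gt0 ?n0 ?C0.
have lnhi : ln (Gcov d f n e)%:R <= ln C%:R + a%:R * ln n%:R :> R.
  by rewrite -lnna -lnM ?posn ?expn_gt0 ?n0 // -natrM ler_ln ?posn ?ler_nat
    ?muln_gt0 ?expn_gt0 ?n0 ?C0.
rewrite /= -[X in `|X - _|](mulfK (lt0r_neq0 lnn0)) -mulrBl normrM.
rewrite (gtr0_norm (x := (ln n%:R)^-1)) ?invr_gt0 // ler_pdivrMr //.
by rewrite ler_norml; lra.
Unshelve. all: by end_near. Qed.

Lemma hpolE (e0 : R) (l : \bar R) : 0 < e0 ->
  (forall e, 0 < e -> e < e0 -> hpol_eps d f e = l) -> hpol d f = l.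
Proof.
move=> e0_gt0 eps; apply: lim_near_cst; first exact: ereal_hausdorff.
near=> e; apply: eps; near: e; first exact: nbhs_right_gt.
exact: nbhs_right_lt.
Unshelve. all: by end_near. Qed.

(** Two of the points in one ball would be less than [2 r <= e] apart at every time below [n], so
    sending each point to a ball containing it is injective. *)
Lemma separated_leq n (e r : R) k l (z : 'I_k -> T) :
  (forall x y, d x y = d y x) -> (forall x y w, d x w <= d x y + d y w) ->
  (forall i j : 'I_k, (i < j)%N -> exists2 s, (s < n)%N &
     e <= d (iter s f (z i)) (iter s f (z j))) ->
  2 * r <= e -> Defs.covered_by d f n r l -> (k <= l)%N.
Proof.
move=> dC dtri sep re [c cP].
have [g gP] := choice (fun i => cP (z i)).
rewrite -[k]card_ord -[l]card_ord; apply: (leq_card g).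
have ginj (i j : 'I_k) : (i < j)%N -> g i <> g j.
  move=> ij gij; have [s sn] := sep i j ij.
  have := dyn_dist_ltE _ _ _ _ (gP i) s sn.
  have := dyn_dist_ltE _ _ _ _ (gP j) s sn.
  have := dtri (iter s f (z i)) (iter s f (c (g i))) (iter s f (z j)).
  by rewrite gij (dC _ (iter s f (c _))); lra.
move=> i j gij; apply: val_inj.
by have [/ginj|/ginj|//] := ltngtP i j; rewrite gij.
Qed.

End Covers.

(** * Lower and upper bounds for covers of the circle *)

Section CircleCovers.
Context {R : realType}.
Implicit Types (F G : R -> R) (f g h : circle R -> circle R) (p q : circle R).

(* At time [k * j] the point [f^-(k j) p] is back at [p], while [f^-(k i) p],
   [i < j], is at [f^(k (j - i)) p]. *)
Lemma separated_orbit {f h p} {e : R} k n : (0 < k)%N -> (0 < n)%N ->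
  cancel h f ->
  (forall j, (0 < j)%N -> e <= circ_dist (iter (k * j) f p) p) ->
  forall r l, 2 * r <= e -> Defs.covered_by (@circ_dist R) f n r l ->
  (n <= k * l)%N.
Proof.
move=> k0 n0 hK far r l re cov.
(* The number of multiples of [k] in [0, ..., n - 1]. *)
pose b := (n.-1 %/ k).+1.
have : (b <= l)%N.
  apply: (separated_leq _ _ _ _ _ _ _ (fun i : 'I_b => iter (k * i) h p)
    circ_distC circ_dist_triangle _ re cov) => i j ij.
  exists (k * j)%N.
    have : (j <= n.-1 %/ k)%N by rewrite -ltnS.
    by rewrite leq_divRL // mulnC => /leq_ltn_trans; apply; rewrite prednK.
  rewrite (can_iter _ hK).
  have -> : (k * j = k * (j - i) + k * i)%N by rewrite -mulnDr subnK // ltnW.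
  by rewrite iterD (can_iter _ hK) far // subn_gt0.
move=> bl; apply: leq_trans (leq_mul (leqnn k) bl).
by rewrite mulnC -{1}(prednK n0) ltn_ceil.
Qed.

(* Points of [0, 1[ with the same value of
   [\sum_(k < n) floor (N * F^k x)] have, by monotonicity, the same integer
   parts for each [k]; the sum takes at most [n * N + 1] values. *)
Lemma linear_cover {f F G} {e : R} : circle_lift F G ->
  (forall x, f (toT x) = toT (F x)) -> 0 < e ->
  exists N, forall n, Defs.covered_by (@circ_dist R) f n e (n * N).+1.
Proof.
move=> FG fF e0; pose N := (Num.bound e^-1).+1; exists N => n.
have N0 : 0 < N%:R :> R by rewrite ltr0n.
have Ne : 1 < N%:R * e.
  rewrite mulrC -ltr_pdivrMl // mulr1.
  apply: lt_trans (archi_boundP _) _; first by rewrite invr_ge0 ltW.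
  by rewrite ltr_nat.
pose a k (x : R) := Num.floor (N%:R * iter k F x).
pose s x := \sum_(k < n) a k x.
have a_le k x y : x <= y -> a k x <= a k y.
  move=> xy; apply: le_floor.
  by rewrite ler_pM2l // (lift_le (circle_lift_iter k FG)).
have s_le x y : x <= y -> s x <= s y.
  by move=> xy; apply: ler_sum => k _; exact: a_le.
have a1 k : a k 1 = a k 0 + N%:Z.
  rewrite /a -[X in iter k F X]add0r (lift_int (circle_lift_iter k FG) 0 1).
  by rewrite mulrDr mulr1 floorDrz ?intr_int // -[N%:R]/(N%:Z%:~R) intrKfloor.
have s1 : s 1 = s 0 + (n * N)%:Z.
  rewrite /s; under eq_bigr do rewrite a1.
  by rewrite big_split /= sumr_const card_ord PoszM -mulr_natl natz.
pose rk (p : circle R) := absz (s (sval p) - s 0)%R.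
have rkE p : (rk p)%:Z = s (sval p) - s 0.
  rewrite /rk gez0_abs // subr_ge0 s_le //.
  by case: p => x /= /andP[].
have rk_lt p : (rk p < (n * N).+1)%N.
  rewrite ltnS -lez_nat rkE lerBlDl -s1 s_le //.
  by case: p => x /= /andP[_ /ltW].
(* One centre is chosen in each nonempty class of [rk]; values not attained get the dummy centre
   [toT 0]. *)
have [c cP] : exists c : 'I_(n * N).+1 -> circle R,
    forall i, (exists p, rk p = val i) -> rk (c i) = val i.
  suff ex (i : 'I_(n * N).+1) : exists q, (exists p, rk p = i) -> rk q = i.
    by have [c cP] := choice ex; exists c.
  have [[p pi]|np] := pselect (exists p, rk p = i); first by exists p.
  by exists (toT 0) => /np.
exists c => p; exists (Ordinal (rk_lt p)).
set q := c _; have : rk q = rk p by apply: cP; exists p.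
move=> /(congr1 Posz); rewrite !rkE => /addIr spq.
apply: dyn_dist_lt => // k kn.
rewrite -(toT_sval p) -(toT_sval q) !(iter_lift fF).
(* Each term is monotone in the point, so equal sums force equality term by term. *)
have sum_eq x y : x <= y -> s x = s y -> a k x = a k y.
  move=> xy sxy; apply/esym/eqP; rewrite -subr_eq0; apply/eqP.
  apply: (psumr_eq0P (P := predT) (F := fun k : 'I_n => a k y - a k x) _ _
    (i := Ordinal kn)) => //.
    by move=> i _; rewrite subr_ge0 a_le.
  by rewrite sumrB -/(s x) -/(s y) sxy subrr.
have : a k (sval q) = a k (sval p).
  by case: (leP (sval q) (sval p)) => [|/ltW] ?; [|symmetry]; exact: sum_eq.
move=> apq; apply: le_lt_trans (circ_dist_le _ _ 0) _; rewrite addr0.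
have := floor_le (N%:R * iter k F (sval p)).
have := floorD1_gt (N%:R * iter k F (sval p)).
have := floor_le (N%:R * iter k F (sval q)).
have := floorD1_gt (N%:R * iter k F (sval q)).
rewrite -/(a k _) -/(a k (sval p)) apq => ? ? ? ?.
rewrite -(ltr_pM2l N0) -{1}(gtr0_norm N0) -normrM ltr_norml.
by move: (intrD R (a k (sval p)) 1) => ?; lra.
Qed.

(** Heine-Cantor, with compactness taken from the segment [0, 1], which [toT] maps onto the
    circle. *)
Lemma circ_uniform_continuity {g} {e : R} : circ_continuous g -> 0 < e ->
  exists2 r, 0 < r &
    forall p q, circ_dist p q < r -> circ_dist (g p) (g q) < e.
Proof.
move=> gc e0.
pose P r (x : R) :=
  forall q, circ_dist (toT x) q < r -> circ_dist (g (toT x)) (g q) < e.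
have /compact_near_coveringP segP := @segment_compact R 0 1.
have cov : (\forall r \near (0 : R)^'+, `[0%R, 1%R] `<=` P r)%classic.
  apply: segP => x _; have e20 : 0 < e / 2 by lra.
  have [r r0 rP] := gc (toT x) _ e20.
  exists (ball x (r / 2), [set r' | r' < r / 2])%classic.
    split => /=; first by apply: nbhsx_ballx; lra.
    by apply: nbhs_right_lt; lra.
  case=> y r' [/= xy rr'] q yq.
  have {}yq : circ_dist (toT y) q < r / 2 by exact: lt_trans yq rr'.
  have {}xy : circ_dist (toT x) (toT y) < r / 2.
    by apply: le_lt_trans (circ_dist_le _ _ 0) _; rewrite addr0.
  have xq : circ_dist (toT x) q < r.
    rewrite [ltRHS]splitr.
    exact: le_lt_trans (circ_dist_triangle _ (toT y) _) (ltrD xy yq).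
  have {}xy : circ_dist (toT x) (toT y) < r.
    by apply: lt_trans xy _; rewrite ltr_pdivrMr // ltr_pMr // ltr1n.
  rewrite [ltRHS]splitr.
  apply: le_lt_trans (circ_dist_triangle _ (g (toT x)) _) (ltrD _ (rP _ xq)).
  by rewrite circ_distC; exact: rP.
near (at_right (0 : R)) => r; exists r; first by near: r; exact: nbhs_right_gt.
move=> p q; rewrite -{1 2}(toT_sval p).
have : (`[0, 1] `<=` P r)%classic by near: r.
apply; case: p => x /= /andP[x0 x1].
by rewrite /= in_itv /= x0 ltW.
Unshelve. all: by end_near. Qed.

End CircleCovers.

Lemma rotation_nonexpanding {R : realType} (a : R) (p q : circle R) :
  circ_dist (rotation a p) (rotation a q) <= circ_dist p q.
Proof.
rewrite -{2}(toT_sval p) -{2}(toT_sval q).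
have [m ->] := circ_distE (sval p) (sval q).
apply: le_trans (circ_dist_le _ _ m) _.
by rewrite le_eqVlt; apply/orP; left; apply/eqP; congr (`|_|); lra.
Qed.

(** A rotation does not spread points, so a finite [r]-net for it works at all times at once;
    uniform continuity of the inverse conjugacy [g] carries this net to one for [f] at scale [e]. *)
Lemma bounded_cover {R : realType} {f : circle R -> circle R} {e : R} :
  conj_to_rotation f -> 0 < e ->
  exists N, forall n, Defs.covered_by (@circ_dist R) f n e N.
Proof.
move=> [h [a [[g [hK [gK [_ gc]]]] hf]]] e0.
have [r r0 gr] := circ_uniform_continuity gc e0.
pose N := (Num.bound r^-1).+1; exists N => n.
have N0 : 0 < N%:R :> R by rewrite ltr0n.
have Nr : 1 < N%:R * r.
  rewrite mulrC -ltr_pdivrMl // mulr1.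
  apply: lt_trans (archi_boundP _) _; first by rewrite invr_ge0 ltW.
  by rewrite ltr_nat.
have hiter k p : h (iter k f p) = iter k (rotation a) (h p).
  by elim: k => //= k <-; rewrite hf.
exists (fun i => g (toT (i%:R / N%:R))) => p.
have /andP[x0 x1] : 0 <= sval (h p) < 1 by case: (h p).
set x := sval (h p) in x0 x1.
have Nx0 : 0 <= N%:R * x by rewrite mulr_ge0 // ltW.
have iN : (Num.trunc (N%:R * x) < N)%N by rewrite truncn_lt_nat // gtr_pMr.
exists (Ordinal iN); apply: dyn_dist_lt => // k _.
rewrite -(hK (iter k f p)) -(hK (iter k f (g _))) !hiter gK; apply: gr.
apply: (@le_lt_trans _ _ (circ_dist (toT ((Ordinal iN)%:R / N%:R)) (h p))).
  elim: k => //= k; exact: le_trans (rotation_nonexpanding _ _ _).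
rewrite -(toT_sval (h p)) -/x.
apply: le_lt_trans (circ_dist_le _ _ 0) _; rewrite addr0 /=.
have /andP[] := truncn_itv Nx0; rewrite -natr1; set i := _%:R => ? ?.
rewrite -(ltr_pM2l N0) -{1}(gtr0_norm N0) -normrM mulrBr mulrCA.
by rewrite divff ?lt0r_neq0 // mulr1 ltr_norml; lra.
Qed.

Theorem theorem1 (R : realType) (f : circle R -> circle R) :
  circ_homeo f -> orientation_preserving f ->
  (hpol (@circ_dist R) f = 0%E \/ hpol (@circ_dist R) f = 1%E) /\
  (hpol (@circ_dist R) f = 0%E <-> conj_to_rotation f).
Proof.
move=> [h [fK [hK _]]] [F [Fc [Fhomo fF]]].
have [G FG] := lift_of_injective f F (can_inj fK) Fc Fhomo fF.
have [conjf|nconj] := pselect (conj_to_rotation f).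
  suff -> : hpol (@circ_dist R) f = 0%E by split; [left|].
  apply: (hpolE _ _ 1) => // e e0 _.
  have [N covN] := bounded_cover conjf e0.
  apply: (hpol_epsE _ _ _ 0 N.+1) => // n _; rewrite expn0 muln1.
  have [[c cov] GN] := GcovP _ _ _ _ _ (covN n).
  (* The circle is nonempty, so a cover has at least one ball: this is the lower bound for exponent
     0. *)
  have [i _] := cov (toT 0).
  split; last exact: leqW.
  by rewrite muln_gt0 /=; exact: leq_trans (ltn_ord i).
suff h1 : hpol (@circ_dist R) f = 1%E.
  split; [by right | split=> // h0].
  by move: h1; rewrite h0 => -[] /eqP; rewrite eq_sym oner_eq0.
have [[k [p [e [k0 [e0 far]]]]]|near] := pselect (exists k p (e : R),
    (0 < k)%N /\ 0 < e /\
    forall j, (0 < j)%N -> e <= circ_dist (iter (k * j) f p) p); last first.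
  case: nconj; apply: (recurrent_conj FG fF) => k p e k0 e0.
  apply: contrapT => far; apply: near; exists k, p, e; do 2!split=> //.
  move=> j j0; rewrite leNgt; apply/negP => close.
  by apply: far; exists j.
(* Below [e / 2], no ball contains two [e]-separated points. *)
apply: (hpolE _ _ (e / 2)); first by rewrite divr_gt0.
move=> r r0 re; have [N covN] := linear_cover FG fF r0.
(* The summand [k] serves the lower bound [n <= k G_n], and [N + 1] the upper bound
   [G_n <= n N + 1 <= (N + 1) n]. *)
apply: (hpol_epsE _ _ _ 1 (k + N.+1)) => [|n n1]; first by rewrite addnS.
have n0 : (0 < n)%N by exact: ltn_trans n1.
have [cov GN] := GcovP _ _ _ _ _ (covN n); rewrite expn1; split.
  apply: leq_trans (separated_orbit k n k0 n0 hK far r _ _ cov) _; first lra.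
  by rewrite leq_mul2r leq_addr orbT.
apply: leq_trans GN _; rewrite mulnDl mulSn [(N * n)%N]mulnC.
by rewrite addnA -addn1 addnC leq_add2r (leq_trans n0) // leq_addl.
Qed.
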